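(* Let $m\ge 2$ be an integer, let $G$ be an $(m-1)$-torsion free group with identity $e$, and let $R=\bigoplus_{g\in G}R_g$ be a $G$-graded commutative ring of finite support such that $J(R)\subseteq J^g(R)$ and $m-1\in U(R)$. Let $n\ge 1$ be an integer and $\overline{\sigma}=(e,e,\ldots,e)\in G^n$. If $R$ is a graded $m$-nil clean ring, then $M_n(R)(\overline{\sigma})$ is also a graded $m$-nil clean ring.
   Context: Rings are associative with identity; $U(R)$ is the group of units and $J(R)$ the Jacobson radical of $R$. A ring $R$ is $G$-graded if $R=\bigoplus_{g\in G}R_g$ with additive subgroups satisfying $R_gR_h\subseteq R_{gh}$; elements of $\bigcup_g R_g$ are homogeneous; $R$ has finite support if $\{g\in G: R_g\ne 0\}$ is finite. A right ideal $M$ is homogeneous if $M=\bigoplus_g(M\cap R_g)$; a proper homogeneous right ideal is graded-maximal if no proper homogeneous right ideal properly contains it; the graded Jacobson radical $J^g(R)$ is the intersection of all graded-maximal right ideals. For $\overline{\sigma}=(g_1,\dots,g_n)\in G^n$, $M_n(R)(\overline{\sigma})$ denotes the matrix ring $M_n(R)$ with the $G$-grading whose component of degree $\lambda\in G$ is $M_n(R)_\lambda(\overline{\sigma})=\{(a_{ij}): a_{ij}\in R_{g_i\lambda g_j^{-1}}\}$; for $\overline{\sigma}=(e,\dots,e)$ this is $M_n(R_\lambda)$, the matrices with all entries in $R_\lambda$. An element $f$ is $m$-potent if $f^m=f$. A $G$-graded ring is graded $m$-nil clean if every homogeneous element is the sum of a homogeneous $m$-potent and a homogeneous nilpotent. A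 group $G$ is $k$-torsion free if $g^k=e$ implies $g=e$ for every $g\in G$. *)

(* Defs.v *)
From HB Require Import structures.
From mathcomp Require Import all_boot all_order all_algebra.
From mathcomp Require Import boolp classical_sets cardinality fsbigop.

Set Implicit Arguments.
Unset Strict Implicit.
Unset Printing Implicit Defensive.

Import GRing.Theory.

Local Open Scope classical_set_scope.
Local Open Scope ring_scope.

Definition torsion_free (k : nat) (G : groupType) : Prop :=
  forall g : G, (g ^+ k = 1)%g -> g = 1%g.

(* Two-sided invertibility, so that no decision procedure for units is
   required of R. *)
Definition invertible (R : pzRingType) (x : R) : Prop :=
  exists y : R, x * y = 1 /\ y * x = 1.

Definition mpotent (R : pzRingType) (m : nat) (f : R) : Prop := f ^+ m = f.

Definition nilpotent_elt (R : pzRingType) (b : R) : Prop :=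
  exists k : nat, b ^+ k = 0.

Definition additive_subgroup (V : zmodType) (M : set V) : Prop :=
  M 0 /\ (forall x y, M x -> M y -> M (x - y)).

Definition decomposition (I : choiceType) (V : zmodType) (B : I -> set V)
    (x : V) (c : I -> V) : Prop :=
  [/\ forall i, B i (c i),
      finite_set [set i | c i != 0]
    & x = \sum_(i \in [set: I]) c i].

(* M is the internal direct sum of the B i; meant for additive subgroups M
   and B i. *)
Definition direct_sum (I : choiceType) (V : zmodType) (M : set V)
    (B : I -> set V) : Prop :=
  (forall i, B i `<=` M) /\
  (forall x, M x -> exists! c : I -> V, decomposition B x c).

Definition right_ideal (R : pzRingType) (M : set R) : Prop :=
  additive_subgroup M /\ (forall x a, M x -> M (x * a)).

Definition proper_right_ideal (R : pzRingType) (M : set R) : Prop :=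
  right_ideal M /\ M != [set: R].

Definition maximal_right_ideal (R : pzRingType) (M : set R) : Prop :=
  proper_right_ideal M /\
  (forall N : set R, proper_right_ideal N -> ~ (M `<` N)).

Definition jacobson (R : pzRingType) : set R :=
  \bigcap_(M in [set M : set R | maximal_right_ideal M]) M.

Arguments jacobson : clear implicits.

Definition grading (G : groupType) (R : pzRingType) (A : G -> set R) : Prop :=
  [/\ forall g, additive_subgroup (A g),
      direct_sum [set: R] A
    & forall g h x y, A g x -> A h y -> A (g * h)%g (x * y)].

Definition finite_support_grading (G : groupType) (R : pzRingType)
    (A : G -> set R) : Prop :=
  finite_set [set g | A g != [set 0]].

Definition homogeneous (G : groupType) (R : pzRingType) (A : G -> set R) :
    set R :=
  \bigcup_g A g.

Definition proper_homogeneous_right_ideal (G : groupType) (R : pzRingType)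
    (A : G -> set R) (M : set R) : Prop :=
  proper_right_ideal M /\ direct_sum M (fun g => M `&` A g).

Definition graded_maximal (G : groupType) (R : pzRingType) (A : G -> set R)
    (M : set R) : Prop :=
  proper_homogeneous_right_ideal A M /\
  (forall N : set R, proper_homogeneous_right_ideal A N -> ~ (M `<` N)).

Definition graded_jacobson (G : groupType) (R : pzRingType)
    (A : G -> set R) : set R :=
  \bigcap_(M in [set M : set R | graded_maximal A M]) M.

Definition graded_mnil_clean (m : nat) (G : groupType) (R : pzRingType)
    (A : G -> set R) : Prop :=
  grading A /\
  (forall x, homogeneous A x -> exists f b : R,
     [/\ homogeneous A f /\ mpotent m f,
         homogeneous A b /\ nilpotent_elt b
       & x = f + b]).

Definition matrix_grading (G : groupType) (R : pzRingType) (A : G -> set R)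
    (n : nat) (sigma : 'I_n -> G) (lambda : G) : set 'M[R]_n :=
  [set a : 'M[R]_n | forall i j, A (sigma i * lambda * (sigma j)^-1)%g (a i j)].

(* Main.v *)
Require Import Defs.
From HB Require Import structures.
From mathcomp Require Import all_boot all_order all_algebra.
From mathcomp Require Import finmap.
From mathcomp Require Import boolp classical_sets cardinality fsbigop.
From mathcomp Require Import ring_quotient ring zify.

Set Implicit Arguments.
Unset Strict Implicit.
Unset Printing Implicit Defensive.

Import GRing.Theory.

Local Open Scope classical_set_scope.
Local Open Scope ring_scope.

(** A homogeneous [m]-potent [f] of degree [g] satisfies [g ^ m = g] unless
    [f = 0], so torsion-freeness puts it in degree [1].  Hence the components
    [A g] with [g <> 1] consist of nilpotents ([nil_component]), whereas every
    [x] in the commutative subring [S := A 1] has [x ^ m - x] nilpotent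
    ([subr_exp_nilpotent]).  The matrices of degree [g <> 1] are therefore
    nilpotent ([nilpotent_entries]), and everything reduces to showing that
    each matrix over [S] is the sum of an [m]-potent and a nilpotent
    ([split_matrix]).

    This is a local-to-global argument.  If a matrix [X] fails to split, Zorn's
    lemma gives an ideal [Q] of [S] maximal among those modulo which [X] does
    not split ([maximal_failing_ideal]); it remains to contradict the existence
    of [T := S / Q], over which [X] splits modulo every nonzero principal ideal.
    A nonzero [a] in [T] with [a ^ 2 = 0] is impossible, since one Newton step
    for the polynomial [Z ^ m - Z], whose derivative is invertible at its roots
    because [m - 1] is a unit, turns a splitting modulo [a] into a splitting
    ([split_of_square_zero]).  So [T] is reduced and [x ^ m = x] holds in it.
    A nontrivial idempotent [e] is impossible too, since splittings modulo [e]
    and modulo [1 - e] can be glued ([split_of_idempotent]).  Then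
    [x ^ (m - 1)] is [1] for all nonzero [x], and [T] is a field.

    Over a field [K] in which [x ^ m = x] ([split_matrix_field]), a matrix with
    a proper invariant subspace is block triangular and induction on the size
    applies, so [X] may be taken to have a cyclic vector.  In a basis
    [w_0, w_1, ...] with [w_i X = d_i w_i + w_(i+1)] for all [i] but the last,
    [X] is a strictly triangular matrix plus a matrix [F] with diagonal
    [d_0, ..., d_(n-1), t], zero outside the diagonal and the last row.  Here
    the [d_i] are free and [t] is dictated by the trace; if [t] is none of the
    [d_i], then [F] is diagonalizable over [K], hence [m]-potent.  Suitable
    [d_i] are at hand except in characteristic [2] for even size and trace [0];
    there a basis adapted to an idempotent [F] of rank [2] works from size [3]
    on, and in size [2] a square root of the determinant gives a scalar [F]. *)

(** * Matrices over a field with [x ^ m = x] *)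

Definition mnil_split (B : pzRingType) (m : nat) (x : B) : Prop :=
  exists f : B, mpotent m f /\ nilpotent_elt (x - f).

Section Field.
Variable K : fieldType.

Lemma intertwine_exp n (W X Y : 'M[K]_n) k :
  W *m X = Y *m W -> W *m X ^+ k = Y ^+ k *m W.
Proof.
move=> e; elim: k => [|k IH]; first by rewrite mulmx1 mul1mx.
by rewrite [X ^+ _]exprSr [Y ^+ _]exprSr -!mulmxE mulmxA IH -!mulmxA e.
Qed.

Lemma intertwine_mpotent n (W X Y : 'M[K]_n) m :
  W \in unitmx -> W *m X = Y *m W -> mpotent m Y -> mpotent m X.
Proof.
move=> uW e mY; rewrite /mpotent; apply: (can_inj (mulKmx uW)).
by rewrite (intertwine_exp _ e) mY e.
Qed.

Lemma intertwine_nilpotent n (W X Y : 'M[K]_n) :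
  W \in unitmx -> W *m X = Y *m W -> nilpotent_elt Y -> nilpotent_elt X.
Proof.
move=> uW e [k kY]; exists k; apply: (can_inj (mulKmx uW)).
by rewrite (intertwine_exp _ e) kY mulmx0 mul0mx.
Qed.

(** The splittings of a matrix do not depend on the basis; [W] is the matrix of
    the change of basis. *)
Lemma intertwine_split n (W X Y : 'M[K]_n) m :
  W \in unitmx -> W *m X = Y *m W -> mnil_split m Y -> mnil_split m X.
Proof.
move=> uW e [f [mf nf]]; pose g := invmx W *m (f *m W).
have gW : W *m g = f *m W by rewrite mulKVmx.
exists g; split; first exact: intertwine_mpotent gW mf.
apply: (intertwine_nilpotent uW) nf.
by rewrite mulmxBr mulmxBl e gW.
Qed.

Lemma block_lower_exp n1 n2 (A : 'M[K]_n1) (C : 'M[K]_(n2, n1)) (D : 'M[K]_n2)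
    k :
  exists C', (block_mx A 0 C D : 'M_(n1 + n2)) ^+ k
    = block_mx (A ^+ k) 0 C' (D ^+ k).
Proof.
elim: k => [|k [C' IH]]; first by exists 0; rewrite !expr0 -scalar_mx_block.
eexists; rewrite exprS IH -mulmxE mulmx_block !mulmx0 !mul0mx !addr0 !add0r.
by rewrite !exprS -!mulmxE.
Qed.

(** The zero off-diagonal block of the [m]-potent part leaves [m]-potents on the
    diagonal, and a block triangular matrix with nilpotent diagonal blocks is
    nilpotent. *)
Lemma split_block n1 n2 (X : 'M[K]_(n1 + n2)) m :
  ursubmx X = 0 -> mnil_split m (ulsubmx X) -> mnil_split m (drsubmx X) ->
  mnil_split m X.
Proof.
move=> X0 [f1 [m1 [k1 n1X]]] [f2 [m2 [k2 n2X]]].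
exists (block_mx f1 0 0 f2); split.
  rewrite /mpotent; suff -> : forall k, (block_mx f1 0 0 f2 : 'M_(n1 + n2)) ^+ k
      = block_mx (f1 ^+ k) 0 0 (f2 ^+ k) by rewrite m1 m2.
  elim=> [|k IH]; first by rewrite !expr0 -scalar_mx_block.
  rewrite exprS IH -mulmxE mulmx_block !mulmx0 !mul0mx !addr0 !add0r.
  by rewrite !exprS -!mulmxE.
exists ((k1 + k2) * 2)%N; rewrite -[X]submxK X0 opp_block_mx add_block_mx !subr0.
have [C CE] := block_lower_exp (ulsubmx X - f1) (dlsubmx X) (drsubmx X - f2)
  (k1 + k2).
rewrite exprM CE exprD n1X mul0r [in X in block_mx _ _ _ X]addnC exprD n2X mul0r.
by rewrite expr2 -mulmxE mulmx_block !mulmx0 !mul0mx !addr0 block_mx0.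
Qed.

Lemma split_lower_block n r (X : 'M[K]_n) m : (0 < r < n)%N ->
  (forall i j : 'I_n, (i < r)%N -> (r <= j)%N -> X i j = 0) ->
  (forall n' (Y : 'M[K]_n'), (n' < n)%N -> mnil_split m Y) -> mnil_split m X.
Proof.
move=> /andP[r0 rn]; have [s nE] : exists s, n = (r + s)%N.
  by exists (n - r)%N; lia.
subst n => X0 IH; apply: split_block; [|by apply: IH; lia|by apply: IH; lia].
by apply/matrixP => i j; rewrite !mxE X0 //= ?leq_addr.
Qed.

(** The extended row basis of [U] is a basis of the whole space that starts with
    a basis of the row space of [U]; in it [X] is block triangular. *)
Lemma split_invariant n (X U : 'M[K]_n) m :
  (0 < \rank U < n)%N -> (U *m X <= U)%MS ->
  (forall n' (Y : 'M[K]_n'), (n' < n)%N -> mnil_split m Y) -> mnil_split m X.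
Proof.
move=> r0n UX IH.
have uQ := row_ebase_unit U; set Q := row_ebase U in uQ *.
pose B : 'M_n := pid_mx (\rank U) *m Q.
have UE : U = col_ebase U *m B by rewrite mulmxA mulmx_ebase.
have BU : (B <= U)%MS.
  have -> : B = invmx (col_ebase U) *m U by rewrite {2}UE mulKmx ?col_ebase_unit.
  exact: submxMl.
have UB : (U <= B)%MS by rewrite {1}UE submxMl.
have /submxP[Z ZE] : (B *m X <= B)%MS.
  by apply: submx_trans (submxMr X BU) (submx_trans UX UB).
pose Y := Q *m X *m invmx Q.
have QX : Q *m X = Y *m Q by rewrite mulmxKV.
apply: (intertwine_split uQ QX).
have Y0 (i j : 'I_n) : (i < \rank U)%N -> (\rank U <= j)%N -> Y i j = 0.
  move=> ir jr.
  have : pid_mx (\rank U) *m Y = Z *m pid_mx (\rank U).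
    rewrite /Y !mulmxA -/B ZE -/B /B.
    by rewrite mulmxA mulmxK.
  move/matrixP/(_ i j); rewrite [LHS]mxE [RHS]mxE (bigD1 i) //= big1 => [|k ki].
    rewrite mxE eqxx ir mul1r addr0 => ->; rewrite big1 // => k _.
    by rewrite mxE; case: eqP => [->|_]; rewrite ?mulr0 // ltnNge jr mulr0.
  by rewrite mxE -[_ == _ :> nat]/(i == k) eq_sym (negPf ki) mul0r.
exact: split_lower_block r0n Y0 IH.
Qed.

Definition krylov n (v : 'rV[K]_n) (X : 'M[K]_n) : 'M[K]_n :=
  \matrix_(i < n) (v *m X ^+ i).

(** By the Cayley-Hamilton theorem [v X ^ n] is a combination of the lower
    powers, so this row space is an invariant subspace. *)
Lemma krylov_invariant n (v : 'rV[K]_n) X : (krylov v X *m X <= krylov v X)%MS.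
Proof.
case: n v X => [|n] v X; first by rewrite [krylov v X]thinmx0 mul0mx.
have step k : v *m X ^+ k *m X = v *m X ^+ k.+1.
  by rewrite -mulmxA exprSr -mulmxE.
have rowk k : (k < n.+1)%N -> (v *m X ^+ k <= krylov v X)%MS.
  move=> kn.
  by rewrite -(rowK (fun i : 'I_n.+1 => v *m X ^+ i) (Ordinal kn)) row_sub.
apply/row_subP => i; rewrite row_mul rowK step.
have := ltn_ord i; rewrite ltnS leq_eqVlt => /orP[/eqP -> | ?]; last exact: rowk.
have /eqP := Cayley_Hamilton X.
rewrite -[char_poly X]coefK poly_def size_char_poly linear_sum big_ord_recr /=.
have -> : (char_poly X)`_n.+1 = 1.
  by have := char_poly_monic X; rewrite monicE lead_coefE size_char_poly => /eqP.
rewrite scale1r rmorphXn /= horner_mx_X addrC addr_eq0 => /eqP ->.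
rewrite mulmxN mulmx_sumr eqmx_opp; apply: summx_sub => j _.
by rewrite linearZ rmorphXn /= horner_mx_X -scalemxAr scalemx_sub ?rowk.
Qed.

(** By induction [v X ^ k] lies in the span of the rows of [W] of index at most
    [k], so the rows of [W] span whenever [v] is a cyclic vector. *)
Lemma unit_of_krylov n (v : 'rV[K]_n.+1) (X W : 'M[K]_n.+1) :
    krylov v X \in unitmx -> (v <= row 0 W)%MS ->
    (forall i : 'I_n.+1, (i < n)%N ->
       (row i W *m X <= \sum_(k < n.+1 | (k <= i.+1)%N) <<row k W>>)%MS) ->
  W \in unitmx.
Proof.
move=> uK v0 stepW.
have sub k : (k < n.+1)%N ->
    (v *m X ^+ k <= \sum_(j < n.+1 | (j <= k)%N) <<row j W>>)%MS.
  elim: k => [|k IH] kn.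
    rewrite mulmx1; apply: submx_trans v0 _.
    by apply: (sumsmx_sup 0); rewrite ?genmxE.
  rewrite exprSr -mulmxE mulmxA.
  apply: submx_trans (submxMr X (IH (ltnW kn))) _.
  rewrite sumsmxMr; apply/sumsmx_subP => j jk; rewrite (eqmxMr X (genmxE _)).
  have jn : (j < n)%N by rewrite -ltnS; apply: leq_ltn_trans kn.
  apply: submx_trans (stepW j jn) _.
  apply/sumsmx_subP => l lj; apply: (sumsmx_sup l) => //.
  by apply: leq_trans lj _.
rewrite -row_full_unit -sub1mx.
have K1 : (1%:M <= krylov v X)%MS by rewrite sub1mx row_full_unit.
apply: submx_trans K1 _.
apply/row_subP => i; rewrite rowK; apply: submx_trans (sub i (ltn_ord i)) _.
by apply/sumsmx_subP => j _; rewrite genmxE row_sub.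
Qed.

Lemma mpotent_eigenbasis n (T F : 'M[K]_n) (a : 'I_n -> K) m :
  T \in unitmx -> (forall i, row i T *m F = a i *: row i T) ->
  (forall i, a i ^+ m = a i) -> mpotent m F.
Proof.
move=> uT TF am; apply: (can_inj (mulKmx uT)).
apply/row_matrixP => i; rewrite !row_mul TF -[in RHS]am.
elim: {am} m => [|m IH]; first by rewrite mulmx1 scale1r.
by rewrite exprSr -mulmxE mulmxA IH -scalemxAl TF scalerA -exprSr.
Qed.

Lemma strictly_upper_nilpotent n (N : 'M[K]_n) :
  (forall i j : 'I_n, (j <= i)%N -> N i j = 0) -> nilpotent_elt N.
Proof.
move=> N0; exists n.
suff H k : forall i j : 'I_n, (j < i + k)%N -> (N ^+ k) i j = 0.
  by apply/matrixP => i j; rewrite H ?mxE //; have := ltn_ord j; lia.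
elim: k => [|k IH] i j.
  by rewrite addn0 mxE => ji; case: eqP => // ij; rewrite ij ltnn in ji.
move=> jik; rewrite exprSr -mulmxE mxE big1 // => l _.
have [lik|lik] := ltnP l (i + k); first by rewrite IH ?mul0r.
by rewrite [N l j]N0 ?mulr0 //; lia.
Qed.

(** The vectors [v (X - d_0) ... (X - d_(k-1))] of a Newton basis. *)
Fixpoint newton_vector n (v : 'rV[K]_n) (X : 'M[K]_n) (d : nat -> K) k :=
  if k is k'.+1
  then newton_vector v X d k' *m X - d k' *: newton_vector v X d k' else v.

(** In the Newton basis of [d] the matrix [X] becomes [M], with [d_i] on the
    diagonal and [1] above it in all rows but the last, where the diagonal entry
    is [t] by the trace condition.  Dropping the superdiagonal leaves a matrix
    [F] with the eigenvalues [d_i] and [t].  As [t] differs from every [d_i],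
    it is diagonalizable: the rows of [T] form an eigenbasis. *)
Lemma split_cyclic_newton n (v : 'rV[K]_n.+1) (X : 'M[K]_n.+1) (d : nat -> K) t m :
    krylov v X \in unitmx -> (forall x : K, x ^+ m = x) ->
    (forall i, (i < n)%N -> t != d i) -> \tr X = \sum_(i < n) d i + t ->
  mnil_split m X.
Proof.
move=> uK Km td trX.
pose w := newton_vector v X d; pose W := \matrix_(i < n.+1) w i.
have rowW k (kn : (k < n.+1)%N) : row (Ordinal kn) W = w k by rewrite rowK.
have wX k : w k *m X = d k *: w k + w k.+1 by rewrite addrC subrK.
have uW : W \in unitmx.
  apply: unit_of_krylov uK _ _; first by rewrite rowK.
  move=> i ni; rewrite rowK wX addmx_sub ?scalemx_sub //.
    by apply: (sumsmx_sup i); rewrite ?genmxE ?rowK.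
  have i1 : (i.+1 < n.+1)%N by [].
  by apply: (sumsmx_sup (Ordinal i1)); rewrite ?genmxE ?rowW.
pose M := W *m X *m invmx W.
have WX : W *m X = M *m W by rewrite mulmxKV.
apply: (intertwine_split uW WX).
have ME (i j : 'I_n.+1) : (i < n)%N ->
    M i j = d i *+ (i == j) + (j == i.+1 :> nat)%:R.
  move=> ni; have i1 : (i.+1 < n.+1)%N by [].
  have : row i M = d i *: delta_mx 0 i + delta_mx 0 (Ordinal i1).
    apply: (can_inj (mulmxK uW)); rewrite -row_mul -WX row_mul rowK wX.
    by rewrite mulmxDl -scalemxAl -!rowE !rowK.
  by move/rowP/(_ j); rewrite !mxE eqxx /= [j == i]eq_sym mulr_natr.
have Mt : M ord_max ord_max = t.
  have : \tr M = \tr X by rewrite mxtrace_mulC mulmxA mulVmx // mul1mx.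
  rewrite trX /mxtrace big_ord_recr /= (eq_bigr (fun i : 'I_n => d i)).
    by move/addrI.
  by move=> i _; rewrite ME //= eqxx [_ == _.+1]ltn_eqF ?addr0.
clearbody M.
pose F : 'M_n.+1 := \matrix_(i, j) if (i < n)%N then d i *+ (i == j) else M i j.
have last_ord (i : 'I_n.+1) : (i < n)%N = false -> i = ord_max.
  by move=> ni; apply/val_inj => /=; have := ltn_ord i; lia.
exists F; split; last first.
  apply: strictly_upper_nilpotent => i j ji; rewrite !mxE.
  case: ifP => ni; last by rewrite subrr.
  by rewrite ME // ltn_eqF ?addr0 ?subrr.
pose T : 'M_n.+1 := \matrix_(i, j) if (i < n)%N then (i == j)%:R
  else if (j < n)%N then M i j / (t - d j) else 1.
have uT : T \in unitmx.
  rewrite unitmxE det_trig.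
    rewrite big1 ?unitr1 // => i _; rewrite mxE eqxx.
    by case: ifP => // ->.
  apply/is_trig_mxP => i j ij; rewrite mxE.
  have -> : (i < n)%N by have := ltn_ord j; lia.
  by rewrite -val_eqE ltn_eqF.
pose a (i : 'I_n.+1) := if (i < n)%N then d i else t.
apply: (mpotent_eigenbasis (a := a) uT) => [i|i]; last exact: Km.
apply/rowP => j; rewrite !mxE /a; case: ifP => ni.
  rewrite (bigD1 i) //= big1 => [|k ki].
    by rewrite !mxE ni eqxx mul1r addr0 mulr_natr.
  by rewrite !mxE ni eq_sym (negPf ki) mul0r.
rewrite big_ord_recr /= !mxE ltnn ni /= mul1r; have [nj|nj] := ltnP j n.
  rewrite (bigD1 (Ordinal nj)) //= big1 => [|k kj].
    have -> : widen_ord (leqnSn n) (Ordinal nj) = j by apply: val_inj.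
    rewrite !mxE ni nj eqxx mulr1n addr0.
    rewrite (last_ord i ni); have tj : t - d j != 0 by rewrite subr_eq0 td.
    by field.
  rewrite !mxE ni /= ltn_ord; move: kj.
  by rewrite -!val_eqE /= => /negPf ->; rewrite mulr0.
have -> : j = ord_max by apply: last_ord; rewrite ltnNge nj.
rewrite Mt big1 ?add0r ?mulr1 // => k _.
have kn : (widen_ord (leqnSn n) k == ord_max) = false.
  by rewrite -val_eqE /= ltn_eqF.
by rewrite !mxE /= ltn_ord kn mulr0.
Qed.

(** With [y_k := v X ^ k], the Krylov basis is modified in its last vector only,
    to [y_(n+2) - y_(n+1) - b y_n].  Then [X] is the shift [N] plus a matrix [F]
    whose last two rows alone are nonzero, and [b] is chosen so that the lower
    right 2 by 2 block of [F] is the identity, whence [F ^ 2 = F].  This needs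
    trace [0] and characteristic [2]: the trace of [F] is [2]. *)
Lemma split_cyclic_char2 n (v : 'rV[K]_n.+3) (X : 'M[K]_n.+3) m :
    krylov v X \in unitmx -> (0 < m)%N -> (2%:R : K) = 0 -> \tr X = 0 ->
  mnil_split m X.
Proof.
move=> uK m0 char2 trX.
pose y k : 'rV_n.+3 := v *m X ^+ k.
have yX k : y k *m X = y k.+1 by rewrite /y -mulmxA exprSr -mulmxE.
pose i0 : 'I_n.+3 := inord n; pose i1 : 'I_n.+3 := inord n.+1.
have i0E : i0 = n :> nat by rewrite inordK //; lia.
have i1E : i1 = n.+1 :> nat by rewrite inordK //; lia.
pose c := y n.+3 *m invmx (krylov v X).
have cE : y n.+3 = c *m krylov v X by rewrite mulmxKV.
(* [X] is similar to a companion matrix with last row [c], whose trace is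
   its last diagonal entry. *)
have c_last : c 0 ord_max = 0.
  pose C := krylov v X *m X *m invmx (krylov v X).
  have : \tr C = 0 by rewrite mxtrace_mulC mulmxA mulVmx // mul1mx.
  have rowC (i : 'I_n.+3) : row i C = y i.+1 *m invmx (krylov v X).
    by rewrite !row_mul rowK yX.
  rewrite /mxtrace big_ord_recr /= big1 ?add0r => [|i _].
    by have /rowP/(_ ord_max) := rowC ord_max; rewrite [row _ _ _ _]mxE => ->.
  have iS : (i.+1 < n.+3)%N by have := ltn_ord i; lia.
  have /rowP/(_ (widen_ord (leqnSn _) i)) := rowC (widen_ord (leqnSn _) i).
  rewrite mxE => -> /=.
  have -> : y i.+1 = row (Ordinal iS) (krylov v X) by rewrite rowK.
  by rewrite -row_mul mulmxV // !mxE -val_eqE /= gtn_eqF.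
clearbody c.
(* With this [b], the image of the last basis vector has coefficient [0] at
   index [n + 1]. *)
pose b := c 0 i1 - 1.
pose w k := if (k < n.+2)%N then y k else y n.+2 - y n.+1 - b *: y n.
pose W := \matrix_(i < n.+3) w i.
have rowW k (kn : (k < n.+3)%N) : row (Ordinal kn) W = w k by rewrite rowK.
pose u : 'rV_n.+3 := \row_j if (j <= n)%N then c 0 j - b *+ (j == n :> nat) else 0.
pose F : 'M_n.+3 := \matrix_i
  if (i < n.+1)%N then 0
  else if i == n.+1 :> nat then b *: delta_mx 0 i0 + delta_mx 0 i1
  else u + delta_mx 0 ord_max.
pose N : 'M_n.+3 := \matrix_(i, j) ((j == i.+1 :> nat)%:R : K).
have rowN i (iS : (i.+1 < n.+3)%N) (li : (i < n.+3)%N) :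
    row (Ordinal li) N = delta_mx 0 (Ordinal iS).
  by apply/rowP => j; rewrite !mxE.
have uKr : u *m W = y n.+3 - c 0 i1 *: y n.+1 - b *: y n.
  have -> : u *m W = u *m krylov v X.
    rewrite !mulmx_sum_row; apply: eq_bigr => j _; rewrite !rowK mxE /w.
    by case: ifP => jn; [rewrite ifT //; lia|rewrite !scale0r].
  have -> : u = c - c 0 i1 *: delta_mx 0 i1 - b *: delta_mx 0 i0.
    apply/rowP => j; rewrite !mxE eqxx /= -!val_eqE /= i0E i1E.
    have jn := ltn_ord j; have [j0|j0] := ltnP j n.+1.
      rewrite ifT; last by lia.
      by rewrite (ltn_eqF j0) mulr0 subr0 mulr_natr.
    rewrite ifF; last by lia.
    rewrite (gtn_eqF j0) mulr0 subr0; case: eqP => j1.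
      have -> : j = i1 by apply: val_inj; rewrite /= i1E.
      by rewrite mulr1 subrr.
    have -> : j = ord_max by apply: val_inj => /=; lia.
    by rewrite mulr0 subr0 c_last.
  by rewrite !mulmxBl -!scalemxAl -!rowE !rowK -cE i0E i1E.
have WX : W *m X = (F + N) *m W.
  apply/row_matrixP => -[i li]; rewrite !row_mul linearD /= rowW rowK /=.
  have [i_n|n_i] := ltnP i n.+1.
    have iS : (i.+1 < n.+3)%N by lia.
    rewrite (rowN _ iS) add0r -rowE rowW /w !ifT ?yX //; lia.
  have [i_n1|i_n1] := eqVneq i n.+1.
    have iS : (i.+1 < n.+3)%N by lia.
    rewrite (rowN _ iS) !mulmxDl -scalemxAl -!rowE rowW !rowK /w i0E i1E i_n1.
    rewrite !ltnS ltnn leqnn leqnSn yX.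
    by apply/rowP => j; rewrite !mxE; ring.
  have i_n2 : i = n.+2 by lia.
  have -> : row (Ordinal li) N = 0.
    by apply/rowP => j; rewrite !mxE ltn_eqF //= i_n2.
  rewrite addr0 mulmxDl uKr -rowE rowK /w i_n2 /= ltnn !mulmxBl -scalemxAl !yX /b.
  move: (y n) (y n.+1) (y n.+2) (y n.+3) => y0 y1 y2 y3.
  apply/eqP; rewrite -subr_eq0; apply/eqP/rowP => j; rewrite !mxE.
  by rewrite -[RHS](mul0r (y1 0 j - y2 0 j + (c 0 i1 - 1) * y0 0 j)) -char2; ring.
have uW : W \in unitmx.
  apply: unit_of_krylov uK _ _; first by rewrite rowK /w /y /= mulmx1.
  move=> i ni; have iS : (i.+1 < n.+3)%N by [].
  have rowi : row i W = y i by rewrite rowK /w ifT.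
  have rowsub (j : 'I_n.+3) : (j <= i.+1)%N ->
      (row j W <= \sum_(k < n.+3 | (k <= i.+1)%N) <<row k W>>)%MS.
    by move=> ji; apply: (sumsmx_sup j); rewrite ?genmxE.
  rewrite rowi yX; have [i_n|n_i] := ltnP i n.+1.
    by rewrite (_ : y i.+1 = row (Ordinal iS) W) ?rowsub // rowW /w ifT.
  have i_n1 : i = n.+1 :> nat by lia.
  have -> : y i.+1 = row (Ordinal iS) W + row i1 W + b *: row i0 W.
    rewrite rowW !rowK /w i0E i1E i_n1 ltnn leqnn ltnS leqnSn /=.
    by apply/rowP => j; rewrite !mxE; ring.
  have [ai bi] : (i0 <= i.+1)%N /\ (i1 <= i.+1)%N by lia.
  by rewrite !addmx_sub ?scalemx_sub ?rowsub /=.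
apply: (intertwine_split uW WX); exists F; split; last first.
  rewrite addrAC subrr add0r; apply: strictly_upper_nilpotent => i j ji.
  by rewrite mxE ltn_eqF.
have FF : F ^+ 2 = F.
  have F0 (i : 'I_n.+3) : (i < n.+1)%N -> row i F = 0 by move=> ?; rewrite rowK ifT.
  apply/row_matrixP => i; rewrite row_mul [row i F]rowK.
  case: ifP => _; first by rewrite mul0mx.
  case: ifP => _; rewrite mulmxDl -?scalemxAl -!rowE.
    by rewrite F0 ?i0E // scaler0 add0r rowK i1E ltnn eqxx.
  have -> : u *m F = 0.
    rewrite mulmx_sum_row big1 // => j _; rewrite mxE.
    by case: ifP => jn; [rewrite F0 ?scaler0|rewrite scale0r].
  by rewrite add0r rowK ltnNge leqnSn /= gtn_eqF.
rewrite /mpotent; case: m m0 => // m _; elim: m => // m IH.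
by rewrite exprS IH -expr2.
Qed.

(** In characteristic [2] a trace-zero 2 by 2 matrix has square [- det X], which
    is [s ^ 2] here, so [(X - s) ^ 2 = X ^ 2 - s ^ 2 = 0]. *)
Lemma split_2x2_char2 (X : 'M[K]_2) s m :
    (2%:R : K) = 0 -> \tr X = 0 -> s ^+ m = s ->
    s ^+ 2 = X 0 0 ^+ 2 + X 0 1 * X 1 0 ->
  mnil_split m X.
Proof.
move=> char2 trX sm sE; exists s%:M; split; first by rewrite /mpotent -rmorphXn /= sm.
have tr2 : X 1 1 = - X 0 0.
  move: trX; rewrite /mxtrace !big_ord_recl big_ord0 addr0.
  rewrite (_ : lift ord0 ord0 = 1) => [/eqP|]; last exact: val_inj.
  by rewrite addrC addr_eq0 => /eqP.
exists 2%N; apply/matrixP => i j; rewrite expr2 -mulmxE mxE.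
rewrite !big_ord_recl big_ord0 addr0 (_ : lift ord0 ord0 = 1); last exact: val_inj.
have c2 (x : K) : x + x = 0 by rewrite -mulr2n -mulr_natl char2 mul0r.
have I2 (k : 'I_2) : k = 0 \/ k = 1.
  by case: k => -[|[|//]] p; [left|right]; apply: val_inj.
have neg (x : K) : - x = x by apply/eqP; rewrite -subr_eq0 -opprD c2 oppr0.
by case: (I2 i) => ->; case: (I2 j) => ->;
  rewrite !mxE /= ?tr2 !mulr1n ?mulr0n ?subr0 ?neg;
  [rewrite -[RHS](c2 (s ^+ 2 + X 0 0 * s)) {2}sE
  |rewrite -[RHS](c2 (X 0 1 * (X 0 0 + s)))
  |rewrite -[RHS](c2 (X 1 0 * (X 0 0 + s)))
  |rewrite -[RHS](c2 (s ^+ 2 + X 0 0 * s)) {2}sE]; ring.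
Qed.

(** If the first basis vector [v] is not cyclic, its Krylov space is a proper
    invariant subspace.  So let [v] be cyclic, with [n + 1] the size.  If
    [(n + 1) s <> tr X] for some [s], then [d_i := s] for all [i] forces [t <> s].  Otherwise [tr X = 0] and [n + 1 = 0]
    in [K]; outside characteristic [2] one takes [d = (2, 1, ..., 1)] and [t = 0],
    and in characteristic [2] the two preceding lemmas apply; a square root of [a]
    is [a ^ (m / 2)], since [m] is even there. *)
Lemma split_matrix_field m n (X : 'M[K]_n) :
  (1 < m)%N -> (forall x : K, x ^+ m = x) -> (m%:R - 1 : K) != 0 ->
  mnil_split m X.
Proof.
move=> m1 Km m_1; elim/ltn_ind: n X => -[|n] IH X.
  by exists 0; split; [|exists 0%N]; apply/matrixP => -[].
pose v : 'rV[K]_n.+1 := delta_mx 0 0.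
have [uK|uK] := boolP (krylov v X \in unitmx); last first.
  apply: split_invariant (krylov_invariant v X) _ => [|n' Y n'n]; last exact: IH.
  have -> : (\rank (krylov v X) < n.+1)%N.
    by rewrite ltn_neqAle rank_leq_row andbT -/(row_free _) row_free_unit.
  rewrite andbT lt0n mxrank_eq0; apply/eqP => /row_matrixP/(_ 0)/rowP/(_ 0)/eqP.
  by rewrite rowK mulmx1 !mxE eqxx oner_eq0.
have simple := split_cyclic_newton uK Km.
have [[s sX]|nos] := pselect (exists s, n.+1%:R * s != \tr X).
  apply: (simple (fun=> s) (\tr X - n%:R * s)) => [i _|].
    by rewrite subr_eq -{1}[s]mul1r -mulrDl nat1r eq_sym.
  by rewrite sumr_const card_ord mulr_natl addrC subrK.
have trE s : n.+1%:R * s = \tr X.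
  by apply/eqP/negPn/negP => sX; apply: nos; exists s.
have trX : \tr X = 0 by rewrite -(trE 0) mulr0.
have n0 : n.+1%:R = 0 :> K by rewrite -[LHS]mulr1 trE.
have [c2|c2] := eqVneq (2%:R : K) 0; last first.
  case: n n0 {IH trE nos} X v uK simple trX => [|[|n]] n0 X v uK simple trX.
  - by case/eqP: (oner_neq0 K).
  - by rewrite n0 eqxx in c2.
  apply: (simple (fun i => if i is 0%N then 2%:R else 1) 0) => [[|i] _|].
  - by rewrite eq_sym.
  - by rewrite eq_sym oner_neq0.
  rewrite trX big_ord_recl /= sumr_const card_ord addr0 -[LHS]n0.
  by rewrite -natrD add2n.
case: n n0 {IH trE nos simple} X v uK trX => [|[|n]] n0 X v uK trX.
- by case/eqP: (oner_neq0 K).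
- pose a := X 0 0 ^+ 2 + X 0 1 * X 1 0.
  apply: (@split_2x2_char2 _ (a ^+ m./2)) => //.
  have m_even : ~~ odd m.
    apply/negP => om; move: m_1; rewrite -[m]odd_double_half om -muln2.
    by rewrite natrD natrM c2 mulr0 addr0 subrr eqxx.
  by rewrite -exprM muln2 even_halfK // Km.
- by apply: split_cyclic_char2 uK _ c2 trX; lia.
Qed.

End Field.
(** * Ideals and quotients of commutative rings *)

Section Ideals.
Variables (S : comPzRingType) (Q : set S).
Hypothesis idQ : right_ideal Q.

Lemma ideal0 : Q 0. Proof. by case: idQ => -[]. Qed.
Lemma idealB x y : Q x -> Q y -> Q (x - y).
Proof. by case: idQ => -[_ h] _; apply: h. Qed.
Lemma idealN x : Q x -> Q (- x).
Proof. by move=> Qx; rewrite -sub0r; apply: idealB Qx; apply: ideal0. Qed.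
Lemma idealD x y : Q x -> Q y -> Q (x + y).
Proof. by move=> Qx Qy; rewrite -[y]opprK; apply/idealB/idealN. Qed.
Lemma idealMr x a : Q x -> Q (x * a).
Proof. by case: idQ => _ h; apply: h. Qed.
Lemma idealMl x a : Q x -> Q (a * x).
Proof. by rewrite mulrC; apply: idealMr. Qed.
End Ideals.

Lemma quotient_nz (S : comNzRingType) (Q : set S) (idQ : right_ideal Q) : ~ Q 1 ->
  exists (T : comNzRingType) (pi : {rmorphism S -> T}),
    (forall y, exists x, pi x = y) /\ (forall x, pi x = 0 <-> Q x).
Proof.
move=> Q1; pose I : {pred S} := fun x => `[< Q x >].
have clI : idealr_closed I.
  split.
  - exact/asboolP/(ideal0 idQ).
  - by apply/negP => /asboolP.
  - move=> a x y /asboolP Qx /asboolP Qy.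
    by apply/asboolP/(idealD idQ) => //; apply/(idealMl idQ).
pose J : idealr S := HB.pack (I : S -> bool) (isIdealr.Build S I clI).
exists {ideal_quot J}, (\pi_{ideal_quot J})%qT; split=> [y|x].
  by elim/quotW: y => x; exists x.
rewrite -(rmorph0 (\pi_{ideal_quot J})%qT).
split => [/eqP|Qx]; first by rewrite -Quotient.idealrBE subr0 => /asboolP.
by apply/eqP; rewrite -Quotient.idealrBE subr0; apply/asboolP.
Qed.

Lemma quotient_ring (S : comPzRingType) (Q : set S) (idQ : right_ideal Q) : ~ Q 1 ->
  exists (T : comNzRingType) (pi : {rmorphism S -> T}),
    (forall y, exists x, pi x = y) /\ (forall x, pi x = 0 <-> Q x).
Proof.
move=> Q1; have nz : (1 : S) != 0.
  by apply/eqP => e; apply: Q1; rewrite e; apply: ideal0 idQ.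
pose S' : comNzRingType := HB.pack S (GRing.PzSemiRing_isNonZero.Build S nz).
exact: (@quotient_nz S' Q idQ Q1).
Qed.

Lemma field_of_invertible (T : comNzRingType) :
    (forall x : T, x != 0 -> exists y, y * x = 1) ->
  exists (K : fieldType) (f : {rmorphism T -> K}), bijective f.
Proof.
move=> invT.
have inv (x : T) : exists y : T, (x != 0 -> y * x = 1) /\ (x = 0 -> y = 0).
  have [-> | x0] := eqVneq x 0; first by exists 0.
  have [y yx] := invT x x0; exists y; split=> // x0'.
  by rewrite x0' eqxx in x0.
have [iv ivP] := choice inv.
pose K : fieldType := HB.pack T (GRing.ComNzRing_isField.Build T
  (fun x => proj1 (ivP x)) (proj2 (ivP 0) erefl)).
by exists K, (idfun : {rmorphism T -> T}), id.
Qed.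

Definition adjoin_ideal (S : comPzRingType) (Q : set S) (a : S) : set S :=
  [set x | exists q s, Q q /\ x = q + a * s].

Lemma adjoin_is_ideal (S : comPzRingType) (Q : set S) a :
  right_ideal Q -> right_ideal (adjoin_ideal Q a).
Proof.
move=> idQ; split; [split|].
- by exists 0, 0; rewrite mulr0 addr0; split=> //; apply: ideal0.
- move=> _ _ [q [s [Qq ->]]] [q' [s' [Qq' ->]]].
  by exists (q - q'), (s - s'); split; [apply: idealB|ring].
- move=> _ b [q [s [Qq ->]]]; exists (q * b), (s * b).
  by split; [apply: idealMr|ring].
Qed.

Lemma sub_adjoin (S : comPzRingType) (Q : set S) a :
  right_ideal Q -> ~ Q a -> Q `<` adjoin_ideal Q a.
Proof.
move=> idQ Qa; split=> [|sub].
  by move=> x Qx; exists x, 0; rewrite mulr0 addr0.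
by apply/Qa/sub; exists 0, 1; rewrite mulr1 add0r; split=> //; apply: ideal0.
Qed.

(** Zorn's lemma for a property of ideals that descends from the union of a chain
    to one of its members. *)
Lemma maximal_failing_ideal (S : comPzRingType) (P : set S -> Prop) :
    ~ P [set 0] ->
    (forall C : set (set S), (forall Q, C Q -> right_ideal Q) ->
       total_on C subset -> C !=set0 ->
       P (\bigcup_(Q in C) Q) -> exists2 Q, C Q & P Q) ->
  exists Q, [/\ right_ideal Q, ~ P Q &
    forall Q', right_ideal Q' -> Q `<` Q' -> P Q'].
Proof.
move=> P0 chainP.
have id0 : right_ideal [set 0 : S].
  split; [split=> // x y -> ->; exact: subrr|by move=> x a ->; exact: mul0r].
(* The empty set is admitted so that the empty chain has an upper bound. *)
pose bad X := X = set0 \/ right_ideal X /\ ~ P X.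
have [C CP Ctot|Q [badQ maxQ]] := @Zorn_bigcup _ bad.
  pose D := [set Q | C Q /\ Q !=set0].
  have -> : \bigcup_(Q in C) Q = \bigcup_(Q in D) Q.
    apply/seteqP; split=> x [Q]; last by case=> ? _ ?; exists Q.
    by move=> CQ Qx; exists Q => //; split=> //; exists x.
  have DP Q : D Q -> right_ideal Q /\ ~ P Q.
    by move=> [/CP[-> [? []]|]].
  have Dtot : total_on D subset by move=> A B [CA _] [CB _]; apply: Ctot.
  have [D0|/set0P D0] := eqVneq D set0; first by left; rewrite D0 bigcup_set0.
  right; split; last first.
    by move=> /chainP[//|//|//|Q DQ]; [move=> Q /DP[]|have [] := DP Q DQ].
  have [Q0 DQ0] := D0; split; [split|].
  - by exists Q0 => //; apply: ideal0; have [] := DP _ DQ0.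
  - move=> x y [A DA Ax] [B DB By]; have [AB|BA] := Dtot A B DA DB.
      by exists B => //; apply: idealB => //; [have [] := DP _ DB|apply: AB].
    by exists A => //; apply: idealB => //; [have [] := DP _ DA|apply: BA].
  - by move=> x a [A DA Ax]; exists A => //; apply: idealMr => //; have [] := DP _ DA.
case: badQ => [Q0|[idQ PQ]].
  exfalso; apply: (maxQ [set 0]); last by right.
  by rewrite Q0; split=> // /(_ 0 erefl).
exists Q; split=> // Q' idQ' QQ'; apply: contrapT => PQ'.
by apply: maxQ QQ' _; right.
Qed.

Definition entries_in (S : comPzRingType) n (Q : set S) (X : 'M[S]_n) : Prop :=
  forall i j, Q (X i j).

(** A matrix has finitely many entries, so they already lie in one member of the
    chain; this is what makes Zorn's lemma applicable to matrix conditions. *)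
Lemma chain_entries_in (S : comPzRingType) n (C : set (set S)) (X : 'M[S]_n) :
  total_on C subset -> C !=set0 -> entries_in (\bigcup_(Q in C) Q) X ->
  exists2 Q, C Q & entries_in Q X.
Proof.
move=> Ctot [Q0 CQ0] CX.
suff [Q CQ QX] : exists2 Q, C Q &
    forall p, p \in enum {: 'I_n * 'I_n} -> Q (X p.1 p.2).
  by exists Q => // i j; apply: (QX (i, j)); rewrite mem_enum.
elim: (enum _) => [|[i j] s [Q CQ Qs]]; first by exists Q0.
have [Q1 CQ1 Q1ij] := CX i j; have [le|le] := Ctot _ _ CQ CQ1.
  by exists Q1 => // p; rewrite inE => /predU1P[->//|/Qs]; apply: le.
by exists Q => // p; rewrite inE => /predU1P[->/=|/Qs//]; apply: le.
Qed.

(** * Gluing and lifting splittings *)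

Lemma exprD_first_order (C : comPzRingType) (x d : C) k :
  exists w, (x + d) ^+ k.+1 = x ^+ k.+1 + k.+1%:R * x ^+ k * d + d ^+ 2 * w.
Proof.
elim: k => [|k [w IH]]; first by exists 0; rewrite !expr1 expr0; ring.
exists (k.+1%:R * x ^+ k + x * w + d * w).
by rewrite exprS IH -[in RHS]natr1 !exprS; ring.
Qed.

(** [m x ^ (m - 1) - 1] is the derivative of [Z ^ m - Z] at [x], and
    [(1 + y) x ^ (m - 1) - 1] is its inverse up to a multiple of [z], where [y] is
    the inverse of [m - 1]: modulo [z] the power [x ^ (m - 1)] is idempotent, the
    derivative is [-1] where it vanishes and [m - 1] where it is [1].  So the
    Newton iterate [x'] has a defect divisible by the square of the defect [z]
    of [x]. *)
Lemma newton_step (C : comPzRingType) (x y : C) m : (1 < m)%N -> (m%:R - 1) * y = 1 ->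
  let z := x ^+ m - x in let x' := x - z * ((1 + y) * x ^+ m.-1 - 1) in
  exists w, x' ^+ m - x' = z ^+ 2 * w.
Proof.
case: m => [|[|k]] //= _ my; set z := _ - x; set q := x ^+ k.+1.
set M := k.+2%:R in my *.
have My : M * y = 1 + y by rewrite -[X in X + y]my; ring.
have qE : q - q ^+ 2 = - (x ^+ k * z) by rewrite /z /q !exprS; ring.
have key : (1 + y) * q - M * q * ((1 + y) * q - 1) = - ((M + 1 + y) * x ^+ k * z).
  transitivity ((1 + y) * q + M * q - M * q ^+ 2 - (M * y) * q ^+ 2); first ring.
  rewrite My; transitivity ((M + 1 + y) * (q - q ^+ 2)); first ring.
  by rewrite qE; ring.
have [w] := exprD_first_order x (- (z * ((1 + y) * q - 1))) k.+1.
rewrite -/M -/q => ->.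
exists (((1 + y) * q - 1) ^+ 2 * w - (M + 1 + y) * x ^+ k).
have -> : x ^+ k.+2 = z + x by rewrite subrK.
transitivity (z * ((1 + y) * q - M * q * ((1 + y) * q - 1))
  + z ^+ 2 * (((1 + y) * q - 1) ^+ 2 * w)); first ring.
by rewrite key; ring.
Qed.

Definition split_modulo (T : comNzRingType) n (m : nat) (a : T) (X : 'M[T]_n) :=
  exists (F : 'M[T]_n) (k : nat) (Z Z' : 'M[T]_n),
    F ^+ m - F = a *: Z /\ (X - F) ^+ k = a *: Z'.

(** The defect [a Z] of the [m]-potent [F] squares to zero, so a single Newton
    step makes it vanish.  It changes [F] by a multiple of [a], hence the power
    of [X - F] that was a multiple of [a] remains one, and its square is zero. *)
Lemma split_of_square_zero (T : comNzRingType) n m (a y : T) (X : 'M[T]_n.+1) :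
    (1 < m)%N -> (m%:R - 1) * y = 1 -> a ^+ 2 = 0 -> split_modulo m a X ->
  mnil_split m X.
Proof.
move=> m1 my a2 [F [k [Z [Z' [ZE Z'E]]]]].
have a2Z (V W : 'M[T]_n.+1) : (a *: V) * (a *: W) = 0.
  by rewrite -scalerAl -scalerAr scalerA -expr2 a2 scale0r.
have myP : (m%:R - 1) * y%:P = 1 :> {poly T}.
  by rewrite -[1 in RHS]/(1%:P) -my polyCM polyCB polyCMn.
have [w] := newton_step 'X m1 myP; set z := 'X ^+ m - 'X; set x' := 'X - _ => wE.
pose ev := horner_mx F.
have evz : ev z = a *: Z by rewrite /ev /z rmorphB rmorphXn /= horner_mx_X.
exists (ev x'); split.
  apply/eqP; rewrite -subr_eq0 /ev -rmorphXn -rmorphB wE.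
  by rewrite rmorphM rmorphXn /= -/ev evz expr2 a2Z mul0r.
exists (k * 2)%N; rewrite exprM.
have -> : ev x' = F - a *: (Z * ev ((1 + y%:P) * 'X ^+ m.-1 - 1)).
  by rewrite /x' /ev rmorphB rmorphM /= horner_mx_X -/ev evz scalerAl.
rewrite opprB addrCA addrC.
set V := _ * ev _; suff [V' ->] : exists V', (X - F + a *: V) ^+ k = a *: V'.
  by rewrite expr2 a2Z.
suff [V' VE] : exists V', (X - F + a *: V) ^+ k = (X - F) ^+ k + a *: V'.
  by exists (Z' + V'); rewrite VE Z'E scalerDr.
elim: {Z'E} k => [|j [V' VE]]; first by exists 0; rewrite scaler0 addr0.
exists ((X - F) * V' + V * (X - F) ^+ j + V * (a *: V')).
by rewrite exprS VE mulrDl !mulrDr -exprS !scalerDr -!scalerAl -scalerAr !addrA.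
Qed.

(** [F] is correct modulo [e] and [F1] modulo [1 - e]; the ring is the product of
    these two quotients and [(1 - e) F + e F1] corresponds to the pair. *)
Lemma split_of_idempotent (T : comNzRingType) n m (e : T) (X : 'M[T]_n.+1) :
    (0 < m)%N -> e ^+ 2 = e ->
    split_modulo m e X -> split_modulo m (1 - e) X -> mnil_split m X.
Proof.
move=> m0 e2 [F [k [Z [Z' [ZE Z'E]]]]] [F1 [k1 [Z1 [Z1' [Z1E Z1'E]]]]].
have e0 : e * (1 - e) = 0 by rewrite mulrBr mulr1 -expr2 e2 subrr.
have e0' : (1 - e) * e = 0 by rewrite mulrC.
have ee : (1 - e) * (1 - e) = 1 - e by rewrite mulrBr mulr1 e0' subr0.
have glueX (V W : 'M[T]_n.+1) j :
    ((1 - e) *: V + e *: W) ^+ j = (1 - e) *: V ^+ j + e *: W ^+ j.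
  elim: j => [|j IH]; first by rewrite -scalerDl subrK scale1r.
  rewrite exprS IH mulrDl !mulrDr -!scalerAl -!scalerAr !scalerA.
  by rewrite e0 e0' ee -expr2 e2 !scale0r addr0 add0r -!exprS.
exists ((1 - e) *: F + e *: F1); split.
  rewrite /mpotent glueX; apply/eqP; rewrite -subr_eq0 opprD addrACA -!scalerBr.
  by rewrite ZE Z1E !scalerA e0 e0' !scale0r addr0.
exists (k + k1)%N.
have -> : X - ((1 - e) *: F + e *: F1) = (1 - e) *: (X - F) + e *: (X - F1).
  by rewrite !scalerBr addrACA -scalerDl subrK scale1r opprD.
rewrite glueX exprD Z'E addnC exprD Z1'E -!scalerAl !scalerA e0 e0' !scale0r.
by rewrite addr0.
Qed.

Lemma map_mx_exp (S T : pzRingType) (f : {rmorphism S -> T}) n (X : 'M[S]_n) k :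
  map_mx f (X ^+ k) = map_mx f X ^+ k.
Proof.
elim: k => [|k IH]; first by rewrite !expr0 map_mx1.
by rewrite !exprS -!mulmxE map_mxM IH.
Qed.

Lemma reduced_nilpotent (T : comNzRingType) (x : T) :
  (forall a : T, a ^+ 2 = 0 -> a = 0) -> nilpotent_elt x -> x = 0.
Proof.
move=> red [k]; elim: k => [|[|k] IH xk].
- by move/eqP; rewrite expr0 oner_eq0.
- by rewrite -[LHS]expr1.
- apply: IH; apply: red; rewrite -exprM muln2 -addnn addSnnS exprD xk.
  by rewrite mulr0.
Qed.

(** A ring in which [X] splits modulo every nonzero principal ideal without
    splitting itself is reduced by [split_of_square_zero] and connected by
    [split_of_idempotent], hence a field because [x ^ (m - 1)] is idempotent.
    There, however, every matrix splits. *)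
Lemma split_of_proper_quotients (T : comNzRingType) n m (y : T) (X : 'M[T]_n.+1) :
    (1 < m)%N -> (m%:R - 1) * y = 1 ->
    (forall x : T, nilpotent_elt (x ^+ m - x)) ->
    (forall a, a != 0 -> split_modulo m a X) ->
  mnil_split m X.
Proof.
move=> m1 my nilT splitX; apply: contrapT => nosplit.
have red (a : T) : a ^+ 2 = 0 -> a = 0.
  move=> a2; apply/eqP; apply: contrapT => /negP /splitX aX.
  exact: nosplit (split_of_square_zero m1 my a2 aX).
have Tm (x : T) : x ^+ m = x.
  by apply/eqP; rewrite -subr_eq0; apply/eqP/reduced_nilpotent.
have idem (e : T) : e ^+ 2 = e -> e = 0 \/ e = 1.
  move=> e2; have [->|e0] := eqVneq e 0; first by left.
  have [/eqP|e1] := eqVneq (1 - e) 0; first by rewrite subr_eq0 => /eqP; right.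
  case: nosplit; apply: split_of_idempotent e2 _ _; [exact: ltnW| |]; exact: splitX.
have mE : m = m.-2.+2 by lia.
have [|K [phi [psi phiK psiK]]] := @field_of_invertible T.
  move=> x x0; exists (x ^+ m.-2); rewrite -exprSr.
  have : x ^+ m.-2.+1 = 0 \/ x ^+ m.-2.+1 = 1.
    apply: idem; rewrite -exprM muln2 -addnn -addSnnS exprD -mE Tm.
    by rewrite -exprS.
  case=> // xm; move: x0; rewrite -[x]Tm mE exprS xm mulr0 eqxx.
  by [].
have [||F [mF [k kF]]] := @split_matrix_field K m n.+1 (map_mx phi X) m1.
- by move=> x; rewrite -[x]psiK -rmorphXn Tm.
- apply/eqP => e; have := congr1 phi my.
  rewrite rmorphM rmorphB rmorph_nat rmorph1 e mul0r => /eqP.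
  by rewrite eq_sym oner_eq0.
have injphi : injective (map_mx phi : 'M_n.+1 -> 'M_n.+1).
  move=> A B /matrixP AB; apply/matrixP => i j; apply: (can_inj phiK).
  by have := AB i j; rewrite !mxE.
have FE : map_mx phi (map_mx psi F) = F.
  by apply/matrixP => i j; rewrite !mxE psiK.
case: nosplit; exists (map_mx psi F); split.
  by apply: injphi; rewrite map_mx_exp FE.
by exists k; apply: injphi; rewrite map_mx_exp map_mxB FE kF map_mx0.
Qed.

Definition splits_over (S : comPzRingType) n (m : nat) (X : 'M[S]_n) (Q : set S) :=
  exists (F : 'M[S]_n) (k : nat),
    entries_in Q (F ^+ m - F) /\ entries_in Q ((X - F) ^+ k).

Lemma entries_in_lift (S : comPzRingType) (T : pzRingType) (pi : {rmorphism S -> T})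
    n (Q : set S) (X : 'M[S]_n) : (forall x, pi x = 0 <-> Q x) ->
  map_mx pi X = 0 <-> entries_in Q X.
Proof.
move=> piQ; split=> [/matrixP X0 i j|XQ].
  by apply/piQ; have := X0 i j; rewrite !mxE.
by apply/matrixP => i j; rewrite !mxE; apply/piQ/XQ.
Qed.

Lemma entries_in_adjoin (S : comPzRingType) (T : pzRingType) (pi : {rmorphism S -> T})
    n (Q : set S) a (X : 'M[S]_n) : (forall x, pi x = 0 <-> Q x) ->
  entries_in (adjoin_ideal Q a) X -> exists Z, map_mx pi X = pi a *: Z.
Proof.
move=> piQ XQ.
have aX i j : exists z : T, pi (X i j) = pi a * z.
  have [q [s [Qq ->]]] := XQ i j; exists (pi s).
  by rewrite rmorphD rmorphM (piQ q).2 ?add0r.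
have [Z ZE] := choice (fun p : 'I_n * 'I_n => aX p.1 p.2).
by exists (\matrix_(i, j) Z (i, j)); apply/matrixP => i j; rewrite !mxE (ZE (i, j)).
Qed.

(** [split_of_proper_quotients] applies to the quotient by an ideal maximal among
    those modulo which [X] does not split; a splitting there lifts entrywise to a
    splitting modulo the ideal. *)
Lemma split_matrix (S : comPzRingType) n m (y : S) (X : 'M[S]_n) :
    (1 < m)%N -> (m%:R - 1) * y = 1 ->
    (forall x : S, nilpotent_elt (x ^+ m - x)) ->
  mnil_split m X.
Proof.
case: n X => [|n] X m1 my nilS.
  by exists 0; split; [|exists 0%N]; apply/matrixP => -[].
suff [F [k [mF kF]]] : splits_over m X [set 0].
  exists F; split; last by exists k; apply/matrixP => i j; rewrite kF mxE.
  by apply/eqP; rewrite -subr_eq0; apply/eqP/matrixP => i j; rewrite mF mxE.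
apply: contrapT => /maximal_failing_ideal[].
  move=> C idC Ctot C0 [F [k [mF kF]]].
  have [Q1 C1 Q1F] := chain_entries_in Ctot C0 mF.
  have [Q2 C2 Q2F] := chain_entries_in Ctot C0 kF.
  have [le|le] := Ctot _ _ C1 C2.
    by exists Q2 => //; exists F, k; split=> // i j; apply: le.
  by exists Q1 => //; exists F, k; split=> // i j; apply: le.
move=> Q [idQ nosplit maxQ].
have Q1 : ~ Q 1.
  move=> Q1; apply: nosplit; exists 0, 0%N.
  by split=> i j; rewrite -[X in Q X]mul1r; apply: idealMr.
have [T [pi [surj piQ]]] := quotient_ring idQ Q1.
have lift_mx (V : 'M[T]_n.+1) : exists V', map_mx pi V' = V.
  have [s sE] := choice surj; exists (map_mx s V).
  by apply/matrixP => i j; rewrite !mxE.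
have : mnil_split m (map_mx pi X).
  apply: (@split_of_proper_quotients _ _ _ (pi y)) => //.
  - by rewrite -(rmorph_nat pi) -(rmorph1 pi) -rmorphB -rmorphM my.
  - move=> x; have [x' <-] := surj x; have [k xk] := nilS x'.
    by exists k; rewrite -!rmorphXn -rmorphB -rmorphXn xk rmorph0.
  move=> a; have [a' <-] := surj a => a0.
  have Qa : ~ Q a' by move=> /piQ e; rewrite e eqxx in a0.
  have [F [k [mF kF]]] := maxQ _ (adjoin_is_ideal a' idQ) (sub_adjoin idQ Qa).
  have [Z ZE] := entries_in_adjoin piQ mF.
  have [Z' Z'E] := entries_in_adjoin piQ kF.
  exists (map_mx pi F), k, Z, Z'.
  by rewrite -ZE -Z'E map_mxB !map_mx_exp map_mxB.
case=> F [mF [k kF]]; have [F' FE] := lift_mx F; apply: nosplit.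
exists F', k; split; apply/(entries_in_lift _ piQ).
  by rewrite map_mxB map_mx_exp FE mF subrr.
by rewrite map_mx_exp map_mxB FE.
Qed.

(** Modulo an ideal [Q] maximal among those containing no power of [X], a nonzero
    [a] with [a ^ 2 = 0] cannot exist: a power of [X] that is a multiple of [a]
    has square zero.  So the quotient is reduced and the entries of [X], being
    nilpotent, vanish in it. *)
Lemma nilpotent_entries (S : comPzRingType) n (X : 'M[S]_n) :
  entries_in (@nilpotent_elt S) X -> nilpotent_elt X.
Proof.
case: n X => [|n] X nilX; first by exists 0%N; apply/matrixP => -[].
pose P Q := exists k, entries_in Q (X ^+ k).
suff [k Xk] : P [set 0] by exists k; apply/matrixP => i j; rewrite Xk mxE.
apply: contrapT => /maximal_failing_ideal[].
  move=> C idC Ctot C0 [k /(chain_entries_in Ctot C0)[Q CQ Qk]].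
  by exists Q => //; exists k.
move=> Q [idQ nosplit maxQ].
have Q1 : ~ Q 1.
  move=> Q1; apply: nosplit; exists 0%N => i j.
  by rewrite -[X in Q X]mul1r; apply: idealMr.
have [T [pi [surj piQ]]] := quotient_ring idQ Q1.
have red (a : T) : a ^+ 2 = 0 -> a = 0.
  have [a' <-] := surj a => a2; apply/piQ; apply: contrapT => Qa.
  have [k Xk] := maxQ _ (adjoin_is_ideal a' idQ) (sub_adjoin idQ Qa).
  have [Z ZE] := entries_in_adjoin piQ Xk.
  apply: nosplit; exists (k * 2)%N; apply/(entries_in_lift _ piQ).
  rewrite exprM expr2 map_mxM ZE -scalemxAl -scalemxAr scalerA -expr2 a2.
  by rewrite scale0r.
apply: nosplit; exists 1%N => i j; apply/piQ/(reduced_nilpotent red).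
by have [k xk] := nilX i j; exists k; rewrite -rmorphXn xk rmorph0.
Qed.

(** * Components of a grading *)

Section Grading.
Variables (G : groupType).

Section Support.
Variables (V : zmodType) (B : G -> set V) (E : {fset G}).
Hypothesis suppB : forall g x, B g x -> x != 0 -> g \in E.

(** With a common finite set [E] of degrees, decompositions are ordinary finite
    sums indexed by [E]. *)
Lemma decomposition_sum x c :
  decomposition B x c <-> (forall g, B g (c g)) /\ x = \sum_(g <- E) c g.
Proof.
have sumE : (forall g, B g (c g)) ->
    \sum_(g \in [set: G]) c g = \sum_(g <- E) c g.
  move=> Bc; apply: fsbigTE => g gE; apply/eqP; apply: contraNT gE.
  exact: suppB.
split=> [[Bc _ ->]|[Bc ->]]; first by rewrite sumE.
split=> //; last by rewrite sumE.
by apply: (sub_finite_set _ (finite_fset E)) => g /suppB; apply.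
Qed.
End Support.

Variables (R : comPzRingType) (A : G -> set R).
Hypotheses (hA : grading A) (hfin : finite_support_grading A).

Definition support : {fset G} := fset_set [set g | A g != [set 0]].

Lemma mem_support g x : A g x -> x != 0 -> g \in support.
Proof.
move=> Ax x0; rewrite in_fset_set // inE; apply/eqP => A0.
by move: Ax x0; rewrite A0 => ->; rewrite eqxx.
Qed.

Lemma component0 g : A g 0. Proof. by case: hA => /(_ g)[]. Qed.
Lemma componentB g x y : A g x -> A g y -> A g (x - y).
Proof. by case: hA => /(_ g)[_ h] _ _; apply: h. Qed.
Lemma componentD g x y : A g x -> A g y -> A g (x + y).
Proof.
move=> Ax Ay; rewrite -[y]opprK; apply: componentB => //.
by rewrite -sub0r; apply: componentB => //; apply: component0.
Qed.
Lemma componentM g h x y : A g x -> A h y -> A (g * h)%g (x * y).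
Proof. by case: hA => _ _; apply. Qed.
Lemma component_sum g I r (P : pred I) (F : I -> R) :
  (forall i, P i -> A g (F i)) -> A g (\sum_(i <- r | P i) F i).
Proof.
by move=> AF; elim/big_ind: _ => //; [apply: component0|apply: componentD].
Qed.

Lemma decompose x : exists c, (forall g, A g (c g)) /\
  x = \sum_(g <- support) c g.
Proof.
case: hA => _ [_ /(_ x I)[c [cx _]]] _; exists c.
exact/(decomposition_sum mem_support).
Qed.

Lemma decompose_unique c d : (forall g, A g (c g)) -> (forall g, A g (d g)) ->
  \sum_(g <- support) c g = \sum_(g <- support) d g -> c = d.
Proof.
move=> Ac Ad cd; case: hA => _ [_ /(_ (\sum_(g <- support) c g) I)[e [_ eU]]] _.
by rewrite -(eU c) ?(eU d) //; apply/(decomposition_sum mem_support).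
Qed.

Lemma sum_single g x : A g x ->
  x = \sum_(h <- support) if h == g then x else 0.
Proof.
move=> Ax; rewrite -big_mkcond /=; have [gE|gE] := boolP (g \in support).
  by rewrite -big_filter filter_pred1_uniq ?fset_uniq // big_seq1.
have -> : x = 0 by apply/eqP; apply: contraNT gE; apply: mem_support.
by rewrite big1.
Qed.

Lemma component_single g x : A g x -> forall h, A h (if h == g then x else 0).
Proof. by move=> Ax h; case: eqP => [->|_] //; apply: component0. Qed.

Lemma component_sum_eq g x c : A g x -> (forall h, A h (c h)) ->
  x = \sum_(h <- support) c h -> c g = x.
Proof.
move=> Ax Ac xc; suff -> : c = fun h => if h == g then x else 0 by rewrite eqxx.
apply: decompose_unique => //; first exact: component_single.
by rewrite -xc; apply: sum_single.
Qed.

(** The degree [1] component [c 1] of the identity satisfies [c 1 * x = x] for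
    each homogeneous [x], as comparing the terms of degree [h] in [x = 1 * x]
    shows; so it acts as the identity on all of [R]. *)
Lemma component1 : A 1%g 1.
Proof.
have [c [Ac cE]] := decompose 1.
have c1x h x : A h x -> c 1%g * x = x.
  move=> Ax; pose d k := c (k * h^-1)%g * x.
  have Ad k : A k (d k).
    by have := componentM (Ac (k * h^-1)%g) Ax; rewrite mulgVK.
  suff /(component_sum_eq Ax Ad) : x = \sum_(k <- support) d k by rewrite /d mulgV.
  have z (F : G -> R) : (forall k, A k (F k)) ->
      forall k, k \notin support -> F k = 0.
    by move=> AF k kE; apply/eqP; apply: contraNT kE; apply: mem_support.
  rewrite -(fsbigTE support d (z d Ad)).
  rewrite (@reindex_fsbigT _ _ _ _ _ (fun k => k * h)%g); last first.
    by exists (fun k => k * h^-1)%g => k; rewrite ?mulgK ?mulgVK.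
  rewrite (@fsbigTE _ _ _ _ support) => [|k kE].
    rewrite -[LHS]mul1r {1}cE mulr_suml; apply: eq_bigr => k _.
    by rewrite /d mulgK.
  by rewrite /d mulgK z ?mul0r.
suff <- : c 1%g = 1 by [].
rewrite -[LHS]mulr1 [in LHS]cE mulr_sumr [RHS]cE.
by apply: eq_bigr => g _; apply: c1x.
Qed.

Lemma componentX g x k : A g x -> A (g ^+ k)%g (x ^+ k).
Proof.
move=> Ax; elim: k => [|k IH]; first exact: component1.
by rewrite exprS expgS; apply: componentM.
Qed.

Lemma component_disjoint g h x : A g x -> A h x -> g != h -> x = 0.
Proof.
move=> Ag Ah gh.
have := component_sum_eq Ag (component_single Ah) (sum_single Ah).
by rewrite (negPf gh).
Qed.

(** Comparing the degrees of [f ^ m] and [f] gives [f = 0] or [g ^ m = g], and the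
    latter means [g = 1]. *)
Lemma mpotent_degree1 m g f : (1 < m)%N -> torsion_free (m - 1)%N G ->
  A g f -> mpotent m f -> A 1%g f.
Proof.
move=> m1 tG Af mf; have [g1|g1] := eqVneq (g ^+ m)%g g; last first.
  have fm := componentX m Af; rewrite mf in fm.
  by rewrite (component_disjoint fm Af g1); apply: component0.
suff -> : 1%g = g by [].
apply/esym/tG; apply: (mulgI g); rewrite -expgS mulg1 -[RHS]g1.
by congr (_ ^+ _)%g; lia.
Qed.

(** The summand [f] of a clean decomposition [x = f + b] has degree [1]; as [x]
    has no component there, the degree [g] part of the identity reads [x = b] or
    [x = 0]. *)
Lemma nil_component m g x : (1 < m)%N -> torsion_free (m - 1)%N G ->
  graded_mnil_clean m A -> g != 1%g -> A g x -> nilpotent_elt x.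
Proof.
move=> m1 tG [_ clean] g1 Ax.
have [f [b [[[h0 _ Af] mf] [[h _ Ab] nb] xE]]] := clean x (ex_intro2 _ _ g I Ax).
have Af1 := mpotent_degree1 m1 tG Af mf.
have := @component_sum_eq g x
  (fun k => (if k == 1%g then f else 0) + (if k == h then b else 0)) Ax.
have Ac k : A k ((if k == 1%g then f else 0) + (if k == h then b else 0)).
  by apply: componentD; apply: component_single.
move=> /(_ Ac); rewrite big_split /= -!sum_single // => /(_ xE).
rewrite (negPf g1) add0r; case: ifP => _ <- //.
by exists 1%N; rewrite expr1.
Qed.

(** With [x = f + b], the element [x ^ m - x] vanishes modulo [b]. *)
Lemma subr_exp_nilpotent m x : graded_mnil_clean m A -> A 1%g x ->
  nilpotent_elt (x ^+ m - x).
Proof.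
move=> [_ clean] Ax.
have [f [b [[_ mf] [_ [k bk]] ->]]] := clean x (ex_intro2 _ _ 1%g I Ax).
exists k.
have -> : (f + b) ^+ m - (f + b) =
    b * ((\sum_(i < m) (f + b) ^+ (m.-1 - i) * f ^+ i) - 1).
  rewrite mulrBr mulr1; have := subrXX (f + b) f m.
  rewrite mf [f + b - f]addrC addKr => <-.
  by rewrite opprD addrA.
by rewrite exprMn bk mul0r.
Qed.

(** Multiplication by the integer [m - 1] preserves degrees, so the degree [1]
    component of its inverse is again an inverse. *)
Lemma inverse_component1 m : invertible (m%:R - 1 : R) ->
  exists2 y, A 1%g y & (m%:R - 1) * y = 1.
Proof.
move=> [y [my _]]; have [c [Ac yE]] := decompose y.
exists (c 1%g) => //.
apply: (component_sum_eq (c := fun g => (m%:R - 1) * c g) component1).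
  move=> g; rewrite mulrBl mul1r mulr_natl; apply: componentB => //.
  by elim: m {my} => [|m IH]; [exact: component0|rewrite mulrS; apply: componentD].
by rewrite -mulr_sumr -yE.
Qed.

Lemma matrix_gradingE n g (X : 'M[R]_n) :
  matrix_grading A (fun _ => 1%g) g X <-> forall i j, A g (X i j).
Proof.
by split=> AX i j; have := AX i j; rewrite mul1g invg1 mulg1.
Qed.

Lemma matrix_grading_grading n :
  grading (matrix_grading A (fun _ : 'I_n => 1%g)).
Proof.
split=> [g||g h X Y /matrix_gradingE AX /matrix_gradingE AY].
- split=> [|X Y /matrix_gradingE AX /matrix_gradingE AY].
    by apply/matrix_gradingE => i j; rewrite mxE; apply: component0.
  by apply/matrix_gradingE => i j; rewrite !mxE; apply: componentB.
- split=> // X _.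
  have suppM g Y : matrix_grading A (fun _ : 'I_n => 1%g) g Y ->
      Y != 0 -> g \in support.
    move=> /matrix_gradingE AY; apply: contraNT => gE; apply/eqP/matrixP => i j.
    by rewrite mxE; apply/eqP; apply: contraNT gE; apply: mem_support.
  have [c cP] := choice (fun p : 'I_n * 'I_n => decompose (X p.1 p.2)).
  exists (fun g => \matrix_(i, j) c (i, j) g); split.
    apply/(decomposition_sum suppM); split=> [g|].
      by apply/matrix_gradingE => i j; rewrite mxE; have [] := cP (i, j).
    apply/matrixP => i j; rewrite summxE; have [_ /= ->] := cP (i, j).
    by apply: eq_bigr => g _; rewrite mxE.
  move=> D /(decomposition_sum suppM)[AD XE]; apply/funext => g.
  apply/matrixP => i j; rewrite mxE; have [Ac cE] := cP (i, j).
  have /(congr1 (fun F => F g)) // : c (i, j) = fun g => D g i j.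
  apply: decompose_unique => // [k|]; first by have /matrix_gradingE := AD k.
  by rewrite -cE XE summxE.
- apply/matrix_gradingE => i j; rewrite -mulmxE mxE; apply: component_sum => k _.
  exact: componentM.
Qed.

Definition mem_degree1 : {pred R} := fun x => `[< A 1%g x >].

Lemma mem_degree1P x : reflect (A 1%g x) (x \in mem_degree1).
Proof. exact: asboolP. Qed.

Lemma degree1_subring : GRing.subring_closed mem_degree1.
Proof.
split=> [|x y /mem_degree1P Ax /mem_degree1P Ay
         |x y /mem_degree1P Ax /mem_degree1P Ay].
- exact/mem_degree1P/component1.
- exact/mem_degree1P/componentB.
- by apply/mem_degree1P; rewrite -[1%g]mulg1; apply: componentM.
Qed.

(** The component of degree [1] as a ring of its own, so that [split_matrix]
    applies to it. *)
Lemma degree1_ring : exists (S : comPzRingType) (iota : {rmorphism S -> R}),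
  injective iota /\ forall x, A 1%g x <-> exists s, iota s = x.
Proof.
pose U := {x : R | x \in mem_degree1}.
pose S : subComPzRingType mem_degree1 := HB.pack U
  (GRing.SubChoice_isSubComPzRing.Build R _ U degree1_subring).
exists S, (\val : {rmorphism S -> R}); split; first exact: val_inj.
move=> x; split=> [/mem_degree1P Ax|[s <-]].
  by exists (Sub x Ax : S); apply: SubK.
exact/mem_degree1P/(valP s).
Qed.

End Grading.

Theorem theorem4p4 (m : nat) (hm : (2 <= m)%N)
    (G : groupType) (hG : torsion_free (m - 1)%N G)
    (R : comPzRingType) (A : G -> set R) (hA : grading A)
    (hfin : finite_support_grading A)
    (hJ : jacobson R `<=` graded_jacobson A)
    (hunit : invertible (m%:R - 1 : R))
    (n : nat) (hn : (1 <= n)%N)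
    (hclean : graded_mnil_clean m A) :
  graded_mnil_clean m (matrix_grading A (fun _ : 'I_n => 1%g)).
Proof.
split; first exact: matrix_grading_grading.
move=> X [g _ /matrix_gradingE AX].
have hom h (Y : 'M[R]_n) : (forall i j, A h (Y i j)) ->
    homogeneous (matrix_grading A (fun _ : 'I_n => 1%g)) Y.
  by move=> AY; exists h => //; apply/matrix_gradingE.
have [g1|g1] := eqVneq g 1%g; last first.
  exists 0, X; split; last by rewrite add0r.
    split; first by apply: (hom 1%g) => i j; rewrite mxE; apply: component0.
    by rewrite /mpotent expr0n; case: m hm {hG hunit hclean}.
  split; first exact: (hom g).
  by apply: nilpotent_entries => i j; apply: nil_component hm hG hclean g1 (AX i j).
have [S [iota [injS imS]]] := degree1_ring hA hfin.
have lift x : A 1%g x -> exists s, iota s = x by move/imS.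
have [y /lift[y' <-] my] := inverse_component1 hA hfin hunit.
rewrite g1 in AX.
have [Y YE] := choice (fun p : 'I_n * 'I_n => lift _ (AX p.1 p.2)).
pose X' : 'M[S]_n := \matrix_(i, j) Y (i, j).
have X'E : map_mx iota X' = X by apply/matrixP => i j; rewrite !mxE YE.
have [|x|F [mF [k kF]]] := @split_matrix S n m y' X' hm.
- by apply: injS; rewrite rmorphM rmorphB rmorph_nat rmorph1.
- have Ax : A 1%g (iota x) by apply/imS; exists x.
  have [k xk] := subr_exp_nilpotent hclean Ax.
  by exists k; apply: injS; rewrite rmorphXn rmorphB rmorphXn xk rmorph0.
have homS (Z : 'M[S]_n) :
    homogeneous (matrix_grading A (fun _ : 'I_n => 1%g)) (map_mx iota Z).
  by apply: (hom 1%g) => i j; rewrite mxE; apply/imS; exists (Z i j).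
exists (map_mx iota F), (map_mx iota (X' - F)); split.
- by split=> //; rewrite /mpotent -map_mx_exp mF.
- by split=> //; exists k; rewrite -map_mx_exp kF map_mx0.
- by rewrite map_mxB X'E addrC subrK.
Qed.
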